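(* Let $k$ be a field and let $\mathcal{T}$ be a Hom-finite Krull-Schmidt triangulated $k$-category which is 2-Calabi-Yau, with suspension functor $\Sigma$. An object $T$ in $\mathcal{T}$ is a cluster-tilting object if and only if the following three conditions are satisfied: (a) For all right minimal morphisms $T_1\to T_0$ with $T_0,T_1\in\operatorname{add}T$, all distinguished triangles $T_1\to T_0\to X\xrightarrow{h}\Sigma T_1$ completing that morphism satisfy $\operatorname{Hom}_{\mathcal{T}}(T,h)=0$. (b* ) For all indecomposable objects $X$ of $\mathcal{T}$ there exists a distinguished triangle $T_1\to T_0\to X\xrightarrow{h}\Sigma T_1$ with $T_1,T_0\in\operatorname{add}T$ and $\operatorname{Hom}_{\mathcal{T}}(T,h)=0$. (c) If $T'$ is an indecomposable summand of $T$, then $\Sigma T'\notin\operatorname{add}T$.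
   Context: $\operatorname{add}T$ is the full subcategory of direct summands of finite direct sums of copies of $T$. An object $T$ is a cluster-tilting object if $\operatorname{add}(T)=\{X\mid\operatorname{Hom}_{\mathcal{T}}(T,\Sigma X)=0\}=\{X\mid\operatorname{Hom}_{\mathcal{T}}(X,\Sigma T)=0\}$. A morphism $f:A\to B$ is right minimal if every endomorphism $y$ of $A$ with $f\circ y=f$ is an isomorphism. A Serre functor on $\mathcal{T}$ is an autoequivalence $\mathbb{S}$ such that for each object $X$ there is an isomorphism $D\operatorname{Hom}_{\mathcal{T}}(X,-)\cong\operatorname{Hom}_{\mathcal{T}}(-,\mathbb{S}X)$, where $D=\operatorname{Hom}_k(-,k)$. A triangulated category with Serre functor $\mathbb{S}$ is $d$-Calabi-Yau if $\mathbb{S}=\Sigma^d$ and $d$ is the smallest positive integer for which this holds. *)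

(* Defs.v *)
From mathcomp Require Import all_boot all_order all_algebra.

Set Implicit Arguments.
Unset Strict Implicit.
Unset Printing Implicit Defensive.

Import GRing.Theory.
Local Open Scope ring_scope.

(* Hom-finiteness is built in: each hom space is a vectType, that is, a       *)
(* finite-dimensional k-vector space.                                         *)
Record homFinCat (k : fieldType) := HomFinCat {
  obj :> Type;
  mor : obj -> obj -> vectType k;
  idm : forall X, mor X X;
  compm : forall X Y Z, mor Y Z -> mor X Y -> mor X Z;
  compmA : forall W X Y Z (h : mor Y Z) (g : mor X Y) (f : mor W X),
    compm h (compm g f) = compm (compm h g) f;
  comp1m : forall X Y (f : mor X Y), compm (idm Y) f = f;
  compm1 : forall X Y (f : mor X Y), compm f (idm X) = f;
  comp_linearl : forall X Y Z (f : mor X Y),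
    linear (fun g : mor Y Z => compm g f);
  comp_linearr : forall X Y Z (g : mor Y Z),
    linear (fun f : mor X Y => compm g f) }.

Arguments idm {k C} X : rename.

Notation "g \oc f" := (compm g f) (at level 50, left associativity).

Section Category.
Variables (k : fieldType) (C : homFinCat k).

Definition hom_vanishes (X Y : C) : Prop := forall f : mor X Y, f = 0.

Definition is_iso (X Y : C) (f : mor X Y) : Prop :=
  exists g : mor Y X, g \oc f = idm X /\ f \oc g = idm Y.

Definition zero_object (Z : C) : Prop :=
  forall X : C, hom_vanishes X Z /\ hom_vanishes Z X.

Definition direct_sum (I : finType) (A : I -> C) (S : C) : Prop :=
  exists (inj : forall i, mor (A i) S) (proj : forall i, mor S (A i)),
    [/\ forall i, proj i \oc inj i = idm (A i),
        forall i j, i != j -> proj j \oc inj i = 0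
      & \sum_i (inj i \oc proj i) = idm S].

Definition direct_sum2 (A B S : C) : Prop :=
  direct_sum (fun b : bool => if b then A else B) S.

(* The empty family provides a zero object.                                   *)
Definition additive_category : Prop :=
  forall (n : nat) (A : 'I_n -> C), exists S, direct_sum A S.

Definition summand (A B : C) : Prop := exists A', direct_sum2 A A' B.

Definition in_add (T X : C) : Prop :=
  exists (n : nat) (S : C), direct_sum (fun _ : 'I_n => T) S /\ summand X S.

Definition indecomposable (X : C) : Prop :=
  ~ zero_object X /\
  forall A B, direct_sum2 A B X -> zero_object A \/ zero_object B.

(* Locality of the ring End(X), which need not be commutative, is expressed   *)
(* by closure of its nonunits under addition.                                 *)
Definition local_end (X : C) : Prop :=
  idm X <> 0 /\
  forall f g : mor X X, ~ is_iso f -> ~ is_iso g -> ~ is_iso (f + g).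

Definition krull_schmidt : Prop :=
  forall X : C, exists (n : nat) (A : 'I_n -> C),
    (forall i, local_end (A i)) /\ direct_sum A X.

Definition right_minimal (A B : C) (f : mor A B) : Prop :=
  forall y : mor A A, f \oc y = f -> is_iso y.

End Category.

Record functor (k : fieldType) (C D : homFinCat k) := Functor {
  fobj :> C -> D;
  fmap : forall X Y, mor X Y -> mor (fobj X) (fobj Y);
  fmap_linear : forall X Y, linear (@fmap X Y);
  fmap1 : forall X, fmap (idm X) = idm (fobj X);
  fmapM : forall X Y Z (g : mor Y Z) (f : mor X Y),
    fmap (g \oc f) = fmap g \oc fmap f }.

Section Functors.
Variable k : fieldType.

Definition natural_iso (C D : homFinCat k) (F G : functor C D) : Prop :=
  exists eta : forall X, mor (F X) (G X),
    (forall X, is_iso (eta X)) /\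
    forall X Y (f : mor X Y), eta Y \oc fmap F f = fmap G f \oc eta X.

Definition id_functor (C : homFinCat k) : functor C C.
Proof. by exists (fun X => X) (fun _ _ f => f). Defined.

Definition comp_functor (C D E : homFinCat k)
    (G : functor D E) (F : functor C D) : functor C E.
Proof.
exists (fun X => G (F X)) (fun _ _ f => fmap G (fmap F f)).
- by move=> X Y a f g; rewrite !fmap_linear.
- by move=> X; rewrite !fmap1.
- by move=> X Y Z g f; rewrite !fmapM.
Defined.

Definition iter_functor (C : homFinCat k) (F : functor C C) (n : nat) :
  functor C C := iter n (comp_functor F) (id_functor C).

Definition equivalence (C D : homFinCat k) (F : functor C D) : Prop :=
  exists G : functor D C,
    natural_iso (comp_functor G F) (id_functor C) /\
    natural_iso (comp_functor F G) (id_functor D).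

(* For each X, phi is an isomorphism of functors from Hom(-, S X) to          *)
(* D Hom(X, -), where D V = 'Hom(V, k^o) is the space of linear forms on V.   *)
Definition serre_functor (C : homFinCat k) (S : functor C C) : Prop :=
  equivalence S /\
  forall X : C, exists phi : forall Y, mor Y (S X) -> 'Hom(mor X Y, k^o),
    (forall Y, linear (phi Y) /\ bijective (phi Y)) /\
    forall Y Y' (f : mor Y Y') (a : mor Y' (S X)) (g : mor X Y),
      phi Y (a \oc f) g = phi Y' a (f \oc g).

Record triangulated_axioms (C : homFinCat k) (Sigma : functor C C)
    (dist : forall X Y Z, mor X Y -> mor Y Z -> mor Z (Sigma X) -> Prop) :
    Prop := TriangulatedAxioms {
  tr_additive : additive_category C;
  tr_equivalence : equivalence Sigma;
  tr_iso : forall X Y Z X' Y' Z'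
      (u : mor X Y) (v : mor Y Z) (w : mor Z (Sigma X))
      (u' : mor X' Y') (v' : mor Y' Z') (w' : mor Z' (Sigma X'))
      (a : mor X X') (b : mor Y Y') (c : mor Z Z'),
    is_iso a -> is_iso b -> is_iso c ->
    b \oc u = u' \oc a -> c \oc v = v' \oc b ->
    fmap Sigma a \oc w = w' \oc c ->
    dist X Y Z u v w -> dist X' Y' Z' u' v' w';
  tr_id : forall X Z, zero_object Z -> dist X X Z (idm X) 0 0;
  tr_cone : forall X Y (u : mor X Y),
    exists Z (v : mor Y Z) (w : mor Z (Sigma X)), dist X Y Z u v w;
  tr_rotate : forall X Y Z (u : mor X Y) (v : mor Y Z) (w : mor Z (Sigma X)),
    dist X Y Z u v w <-> dist Y Z (Sigma X) v w (- fmap Sigma u);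
  tr_morphism : forall X Y Z X' Y' Z'
      (u : mor X Y) (v : mor Y Z) (w : mor Z (Sigma X))
      (u' : mor X' Y') (v' : mor Y' Z') (w' : mor Z' (Sigma X'))
      (a : mor X X') (b : mor Y Y'),
    dist X Y Z u v w -> dist X' Y' Z' u' v' w' -> b \oc u = u' \oc a ->
    exists c : mor Z Z', c \oc v = v' \oc b /\ fmap Sigma a \oc w = w' \oc c;
  tr_octahedron : forall X Y Z X' Y' Z'
      (u : mor X Y) (i : mor Y Z') (i' : mor Z' (Sigma X))
      (v : mor Y Z) (j : mor Z X') (j' : mor X' (Sigma Y))
      (l : mor Z Y') (l' : mor Y' (Sigma X)),
    dist X Y Z' u i i' -> dist Y Z X' v j j' -> dist X Z Y' (v \oc u) l l' ->
    exists (f : mor Z' Y') (g : mor Y' X'),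
      dist Z' Y' X' f g (fmap Sigma i \oc j') /\
      [/\ f \oc i = l \oc v, l' \oc f = i', g \oc l = j
        & j' \oc g = fmap Sigma u \oc l'] }.

End Functors.

Record triangCat (k : fieldType) := TriangCat {
  tcat :> homFinCat k;
  susp : functor tcat tcat;
  dist_tri : forall X Y Z : tcat, mor X Y -> mor Y Z -> mor Z (susp X) -> Prop;
  triangCatP : triangulated_axioms dist_tri }.

Arguments susp {k C} : rename.
Arguments dist_tri {k C X Y Z} : rename.

Section CalabiYau.
Variables (k : fieldType) (C : triangCat k).

(* An equality S = Sigma^n of functors is read as a natural isomorphism.      *)
Definition calabi_yau (d : nat) : Prop :=
  exists S : functor C C,
    [/\ serre_functor S, (0 < d)%N, natural_iso S (iter_functor susp d)
      & forall e : nat, (0 < e)%N -> natural_iso S (iter_functor susp e) ->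
          (d <= e)%N].

Definition cluster_tilting (T : C) : Prop :=
  forall X : C,
    (in_add T X <-> hom_vanishes T (susp X)) /\
    (in_add T X <-> hom_vanishes X (susp T)).

End CalabiYau.

(* Main.v *)
Require Import Defs.
From mathcomp Require Import all_boot all_order all_algebra.
From Stdlib Require Import Classical.

Set Implicit Arguments.
Unset Strict Implicit.
Unset Printing Implicit Defensive.

Import GRing.Theory.
Local Open Scope ring_scope.

(** Write add T for the finite sums of copies of T and their summands.

    Call (a), (b) and (c) the three conditions, in the order of the statement.
    If T is cluster-tilting, then Hom(T, Sigma T1) = 0 for T1 in add T, so (a)
    is immediate.  A basis of Hom(T, X) defines a morphism T^n -> X through
    which every T -> X factors; completing it to a triangle
    T1 -> T^n -> X -> Sigma T1, exactness gives Hom(T, Sigma T1) = 0, that is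
    T1 in add T, which is (b).  For (c), if Sigma T' were in add T, then
    Hom(Sigma T', Sigma T), which is Hom(T', T), would vanish, although it
    contains the inclusion of T'.

    Conversely, the point is to prove Hom(T, Sigma T') = 0 for an
    indecomposable summand T' of T ([rigid_on_local_summand]).  A triangle
    T1 -> T0 -> Sigma T' -> Sigma T1 provided by (b) is rotated into
    T' -> T1 -> T0 -> Sigma T'.  Since End(T') is local, T' -> T1 is zero or
    right minimal ([local_right_minimal]).  If it is zero, then Sigma T' is a
    retract of T0, against (c).  If it is right minimal, then (a) says that
    T0 -> Sigma T' kills every T -> T0; but every T -> Sigma T' factors through
    T0 -> Sigma T', so it is zero.  Hence Hom(T, Sigma T) = 0.  Finally, if
    Hom(T, Sigma X) = 0 then Hom(X, Sigma T) = 0 by Serre duality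
    ([calabi_yau2_vanishing]), so for an indecomposable X the last morphism of
    the triangle T1 -> T0 -> X -> Sigma T1 of (b) is zero and X is a retract
    of T0; an arbitrary X is a sum of indecomposable objects.

    Membership in add T is handled through an equivalent condition that is
    visibly closed under retracts and sums: the identity of X is a finite sum
    of composites X -> T -> X ([in_addP]). *)

(** * Functors and equivalences *)

Section Functors.
Variables (k : fieldType) (C D : homFinCat k).
Implicit Types (F : functor C D) (X Y : C).

Lemma fmapD F X Y (f g : mor X Y) : fmap F (f + g) = fmap F f + fmap F g.
Proof. by have := fmap_linear F 1 f g; rewrite !scale1r. Qed.

Lemma fmap0 F X Y : fmap F (0 : mor X Y) = 0.
Proof. by apply: (addrI (fmap F 0)); rewrite -fmapD !addr0. Qed.

Lemma fmap_opp F X Y (f : mor X Y) : fmap F (- f) = - fmap F f.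
Proof. by apply/eqP; rewrite -addr_eq0 -fmapD addNr fmap0. Qed.

Lemma fmap_sum F I (r : seq I) X Y (f : I -> mor X Y) :
  fmap F (\sum_(i <- r) f i) = \sum_(i <- r) fmap F (f i).
Proof.
by elim: r => [|i r IHr]; rewrite ?big_nil ?fmap0 // !big_cons fmapD IHr.
Qed.

Lemma natural_iso_id_faithful F (G : functor D C) X Y (f g : mor X Y) :
  natural_iso (comp_functor G F) (id_functor C) ->
  fmap F f = fmap F g -> f = g.
Proof.
move=> [eta [eta_iso eta_nat]] Ffg.
have [e [_ etaK]] := eta_iso X.
have fgE : f \oc eta X = g \oc eta X.
  by have := eta_nat _ _ f; rewrite /= Ffg => <-; exact: (eta_nat _ _ g).
by rewrite -[f]compm1 -[g]compm1 -etaK !compmA fgE.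
Qed.

End Functors.

Lemma equivalence_faithful (k : fieldType) (C : homFinCat k)
    (F : functor C C) (X Y : C) (f g : mor X Y) :
  equivalence F -> fmap F f = fmap F g -> f = g.
Proof. by case=> G [GF _]; apply: natural_iso_id_faithful GF. Qed.

(** With eta : G F = 1, the preimage of h is the transport of G h along eta; it
    is mapped to h because G is faithful too. *)
Lemma equivalence_full (k : fieldType) (C : homFinCat k)
    (F : functor C C) (X Y : C) (h : mor (F X) (F Y)) :
  equivalence F -> exists f : mor X Y, fmap F f = h.
Proof.
case=> G [[eta [eta_iso eta_nat]] FG].
have [e [eK etaK]] := eta_iso X; have [e' [e'K eta'K]] := eta_iso Y.
exists (eta Y \oc fmap G h \oc e).
apply: (natural_iso_id_faithful FG).
have /(congr1 (fun u => e' \oc u)) := eta_nat _ _ (eta Y \oc fmap G h \oc e).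
by rewrite /= -!compmA eK compm1 !compmA e'K !comp1m.
Qed.

Lemma equivalence_ess_surj (k : fieldType) (C : homFinCat k)
    (F : functor C C) (Z : C) :
  equivalence F -> exists (X : C) (e : mor (F X) Z), is_iso e.
Proof.
by case=> G [_ [eps [eps_iso _]]]; exists (G Z), (eps Z); apply: eps_iso.
Qed.

(** * Linear categories *)

Section LinearCategory.
Variables (k : fieldType) (C : homFinCat k).
Implicit Types X Y Z W T : C.

Lemma compmDl X Y Z (g g' : mor Y Z) (f : mor X Y) :
  (g + g') \oc f = (g \oc f) + (g' \oc f).
Proof. by have := comp_linearl f 1 g g'; rewrite !scale1r. Qed.

Lemma compmDr X Y Z (g : mor Y Z) (f f' : mor X Y) :
  g \oc (f + f') = (g \oc f) + (g \oc f').
Proof. by have := comp_linearr g 1 f f'; rewrite !scale1r. Qed.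

Lemma comp0m X Y Z (f : mor X Y) : (0 : mor Y Z) \oc f = 0.
Proof. by apply: (addrI (0 \oc f)); rewrite -compmDl !addr0. Qed.

Lemma compm0 X Y Z (g : mor Y Z) : g \oc (0 : mor X Y) = 0.
Proof. by apply: (addrI (g \oc 0)); rewrite -compmDr !addr0. Qed.

Lemma compmNl X Y Z (g : mor Y Z) (f : mor X Y) : (- g) \oc f = - (g \oc f).
Proof. by apply/eqP; rewrite -addr_eq0 -compmDl addNr comp0m. Qed.

Lemma compmNr X Y Z (g : mor Y Z) (f : mor X Y) : g \oc (- f) = - (g \oc f).
Proof. by apply/eqP; rewrite -addr_eq0 -compmDr addNr compm0. Qed.

Lemma compmBr X Y Z (g : mor Y Z) (f f' : mor X Y) :
  g \oc (f - f') = (g \oc f) - (g \oc f').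
Proof. by rewrite compmDr compmNr. Qed.

Lemma compm_suml I (r : seq I) X Y Z (G : I -> mor Y Z) (f : mor X Y) :
  (\sum_(i <- r) G i) \oc f = \sum_(i <- r) (G i \oc f).
Proof.
by elim: r => [|i r IHr]; rewrite ?big_nil ?comp0m // !big_cons compmDl IHr.
Qed.

Lemma compm_sumr I (r : seq I) X Y Z (g : mor Y Z) (F : I -> mor X Y) :
  g \oc (\sum_(i <- r) F i) = \sum_(i <- r) (g \oc F i).
Proof.
by elim: r => [|i r IHr]; rewrite ?big_nil ?compm0 // !big_cons compmDr IHr.
Qed.

Lemma compmZr X Y Z a (g : mor Y Z) (f : mor X Y) :
  g \oc (a *: f) = a *: (g \oc f).
Proof. by have := comp_linearr g a f 0; rewrite compm0 !addr0. Qed.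

Lemma iso_id X : is_iso (idm X).
Proof. by exists (idm X); rewrite comp1m. Qed.

Lemma zero_objectP X : zero_object X <-> idm X = 0.
Proof.
split=> [zX|id0 Y]; first by case: (zX X).
by split=> f; [rewrite -[f]comp1m | rewrite -[f]compm1];
  rewrite id0 ?comp0m ?compm0.
Qed.

(** The idempotents of X given by the two terms of a decomposition add up to 1,
    so locality makes one of them invertible; the projection to the other term
    kills that idempotent, so it is zero. *)
Lemma local_indecomposable X : local_end X -> indecomposable X.
Proof.
case=> id_neq0 locX; split=> [/zero_objectP //|A B [inj [proj [pK orth tot]]]].
pose iA : mor A X := inj true; pose pA : mor X A := proj true.
pose iB : mor B X := inj false; pose pB : mor X B := proj false.
have pAK : pA \oc iA = idm A := pK true.
have pBK : pB \oc iB = idm B := pK false.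
have pAB : pA \oc iB = 0 := orth false true isT.
have pBA : pB \oc iA = 0 := orth true false isT.
have {}tot : (iA \oc pA) + (iB \oc pB) = idm X by rewrite -tot big_bool.
have [idA0|idA_neq0] := eqVneq (idm A) 0; first by left; apply/zero_objectP.
have [idB0|idB_neq0] := eqVneq (idm B) 0; first by right; apply/zero_objectP.
exfalso; apply: (locX (iA \oc pA) (iB \oc pB)); last 1 first.
- by rewrite tot; apply: iso_id.
- case=> g [_ gK]; case/eqP: idB_neq0.
  by rewrite -pBK -[pB]compm1 -gK !compmA pBA !comp0m.
case=> g [_ gK]; case/eqP: idA_neq0.
by rewrite -pAK -[pA in LHS]compm1 -gK !compmA pAB !comp0m.
Qed.

(** If f y = f with y not invertible, then f (1 - y) = 0 and 1 - y is
    invertible because End(X) is local. *)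
Lemma local_right_minimal X Y (f : mor X Y) :
  local_end X -> f <> 0 -> right_minimal f.
Proof.
move=> [_ locX] f_neq0 y fy; apply: NNPP => niso_y.
have niso_y' : ~ is_iso (idm X - y).
  case=> g [_ yK]; apply: f_neq0.
  by rewrite -[f]compm1 -yK compmA compmBr compm1 fy subrr comp0m.
by apply: (locX _ _ niso_y niso_y'); rewrite addrC subrK; apply: iso_id.
Qed.

(** The ideal generated by T, with a list rather than a family indexed by some
    'I_n, so that closure under addition is concatenation. *)
Definition factors_via T X Y (f : mor X Y) : Prop :=
  exists s : seq (mor T Y * mor X T), f = \sum_(p <- s) (p.1 \oc p.2).

Lemma factors_via_sum T X Y (I : finType) (F : I -> mor X Y) :
  (forall i, factors_via T (F i)) -> factors_via T (\sum_i F i).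
Proof.
move=> viaF; elim: index_enum => [|i r [s IHr]].
  by exists [::]; rewrite !big_nil.
have [si Fi] := viaF i.
by exists (si ++ s); rewrite big_cons big_cat Fi IHr.
Qed.

Lemma factors_via_comp T X X' Y Y' (g : mor Y Y') (f : mor X Y) (e : mor X' X) :
  factors_via T f -> factors_via T (g \oc f \oc e).
Proof.
case=> s ->; exists [seq (g \oc p.1, p.2 \oc e) | p <- s].
rewrite big_map compm_sumr compm_suml.
by apply: eq_bigr => p _ /=; rewrite !compmA.
Qed.

Lemma in_add_factors_via T X : in_add T X -> factors_via T (idm X).
Proof.
case=> n [S [[inj [proj [_ _ tot]]] [A' [inj' [proj' [pK _ _]]]]]].
have <- : proj' true \oc idm S \oc inj' true = idm X.
  by rewrite compm1; apply: (pK true).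
apply: factors_via_comp; rewrite -tot; apply: factors_via_sum => i.
by exists [:: (inj i, proj i)]; rewrite big_seq1.
Qed.

Lemma factors_via_vanishl T X Y : factors_via T (idm X) ->
  hom_vanishes T Y -> hom_vanishes X Y.
Proof.
case=> s id_eq van f; rewrite -[f]compm1 id_eq compm_sumr.
by rewrite big1 // => p _; rewrite compmA [f \oc _]van comp0m.
Qed.

Lemma factors_via_vanishr (F : functor C C) T X Y : factors_via T (idm X) ->
  hom_vanishes Y (F T) -> hom_vanishes Y (F X).
Proof.
case=> s id_eq van f; rewrite -[f]comp1m -fmap1.
rewrite id_eq fmap_sum compm_suml big1 // => p _.
by rewrite fmapM -compmA [_ \oc f]van compm0.
Qed.

Lemma direct_sum_factors_via T X (I : finType) (A : I -> C) :
  direct_sum A X -> (forall i, factors_via T (idm (A i))) ->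
  factors_via T (idm X).
Proof.
move=> [inj [proj [_ _ <-]]] viaA; apply: factors_via_sum => i.
by rewrite -[inj i]compm1; apply: factors_via_comp.
Qed.

Lemma retract_factors_via T X Y (p : mor Y X) (i : mor X Y) :
  p \oc i = idm X -> factors_via T (idm Y) -> factors_via T (idm X).
Proof. by move=> <- viaY; rewrite -[p]compm1; apply: factors_via_comp. Qed.

End LinearCategory.

(** * Triangulated categories *)

Section Triangulated.
Variables (k : fieldType) (C : triangCat k).
Implicit Types X Y Z W T : C.

Let ax := triangCatP C.
Let equivS : equivalence (@susp k C) := tr_equivalence ax.

Lemma exists_zero_object (X : C) : exists Z : C, zero_object Z.
Proof.
have [Z [inj [proj [_ _ tot]]]] := tr_additive ax (fun _ : 'I_0 => X).
by exists Z; apply/zero_objectP; rewrite -tot big_ord0.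
Qed.

Lemma dist_comp0 X Y Z (u : mor X Y) (v : mor Y Z) (w : mor Z (susp X)) :
  dist_tri u v w -> v \oc u = 0.
Proof.
move=> uvw; have [O zO] := exists_zero_object X.
have [|c [/= <- _]] := tr_morphism ax (a := idm X) (b := u) (tr_id ax X zO) uvw.
  by [].
by rewrite compm0.
Qed.

(** Compare the triangle with W -> 0 -> Sigma W, and use that Sigma is fully
    faithful. *)
Lemma dist_weak_ker X Y Z W (u : mor X Y) (v : mor Y Z) (w : mor Z (susp X))
    (f : mor W Y) :
  dist_tri u v w -> v \oc f = 0 -> exists g : mor W X, f = u \oc g.
Proof.
move=> uvw vf0; have [O zO] := exists_zero_object X.
have triW := (tr_rotate ax _ _ _).1 (tr_id ax W zO).
have vw := (tr_rotate ax _ _ _).1 uvw.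
have [|c [_]] := tr_morphism ax (a := f) (b := 0) triW vw.
  by rewrite vf0 comp0m.
have [c' <-] := equivalence_full c equivS.
rewrite compmNr compmNl -!fmapM compm1 => /oppr_inj Sf.
by exists c'; apply: equivalence_faithful equivS Sf.
Qed.

(** A retract has a complement in a triangulated category: the last morphism w
    of a triangle on i vanishes, because Sigma i is split mono and kills it, so
    its middle morphism v has a section; corrected to be killed by p, that
    section exhibits the cone as a complement of X. *)
Lemma retract_summand X Y (p : mor Y X) (i : mor X Y) :
  p \oc i = idm X -> summand X Y.
Proof.
move=> pi1; have [Z [v [w ivw]]] := tr_cone ax i.
have vi0 := dist_comp0 ivw.
have vw := (tr_rotate ax _ _ _).1 ivw.
have wi := (tr_rotate ax _ _ _).1 vw.
have w0 : w = 0.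
  have := dist_comp0 wi; rewrite compmNl => /eqP; rewrite oppr_eq0 => /eqP Siw0.
  by rewrite -[w]comp1m -fmap1 -pi1 fmapM -compmA Siw0 compm0.
have [s vs] : exists s, idm Z = v \oc s.
  by apply: dist_weak_ker vw _; rewrite w0 comp0m.
pose s' := s - (i \oc (p \oc s)).
have vs' : v \oc s' = idm Z by rewrite compmBr compmA vi0 comp0m subr0.
have ps' : p \oc s' = 0 by rewrite compmBr compmA pi1 comp1m subrr.
have tot : (i \oc p) + (s' \oc v) = idm Y.
  have [|c dE] := dist_weak_ker (f := idm Y - ((i \oc p) + (s' \oc v))) ivw.
    by rewrite compmBr compm1 compmDr !compmA vi0 vs' comp0m comp1m add0r subrr.
  have := congr1 (fun x => p \oc x) dE.
  rewrite compmBr compm1 compmDr !compmA pi1 ps' comp0m !comp1m addr0 subrr.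
  by move=> c0; move: dE; rewrite -c0 compm0 => /eqP; rewrite subr_eq0 => /eqP.
exists Z.
exists (fun b => match b return mor (if b then X else Z) Y with
                 | true => i | false => s' end).
exists (fun b => match b return mor Y (if b then X else Z) with
                 | true => p | false => v end).
by split=> [[]|[] []|] //; rewrite big_bool.
Qed.

(** The morphisms X -> T and T -> X of a decomposition of the identity are the
    components of maps X -> T^n -> X that make X a retract of T^n. *)
Lemma in_addP T X : in_add T X <-> factors_via T (idm X).
Proof.
split=> [|[s id_eq]]; first exact: in_add_factors_via.
have [S sumS] := tr_additive ax (fun _ : 'I_(size s) => T).
exists (size s), S; split=> //.
case: sumS => [inj [proj [pK orth _]]].
pose c (i : 'I_(size s)) := nth (0, 0) s i.
apply: (@retract_summand _ _ (\sum_i ((c i).1 \oc proj i))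
                             (\sum_i (inj i \oc (c i).2))).
rewrite compm_suml id_eq (big_nth (0, 0)) big_mkord; apply: eq_bigr => i _.
rewrite compm_sumr (bigD1 i) //= big1 => [|j ne_ji].
  by rewrite addr0 -compmA (compmA (proj i)) pK comp1m.
by rewrite -compmA (compmA (proj i)) orth // comp0m compm0.
Qed.

Lemma in_add_self T : in_add T T.
Proof.
by apply/in_addP; exists [:: (idm T, idm T)]; rewrite big_seq1 comp1m.
Qed.

Lemma in_add_summand T X : summand X T -> in_add T X.
Proof.
case=> [A' [inj [proj [pK _ _]]]]; apply/in_addP.
exact: retract_factors_via (pK true) (in_add_factors_via (in_add_self T)).
Qed.

(** A triangle whose last morphism is zero makes X a retract of T0. *)
Lemma split_triangle_in_add T T1 T0 X (f : mor T1 T0) (g : mor T0 X) :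
  in_add T T0 -> dist_tri f g 0 -> in_add T X.
Proof.
move=> /in_addP addT0 /(tr_rotate ax) tri.
have [|s gs] := dist_weak_ker (f := idm X) tri; first by rewrite comp0m.
exact/in_addP/(retract_factors_via (esym gs) addT0).
Qed.

(** The cone of g is isomorphic to some Sigma X; transporting the triangle along
    this isomorphism and rotating it back, with the sign of the rotation, puts X
    in front. *)
Lemma exists_cocone Y Z (g : mor Y Z) :
  exists (X : C) (u : mor X Y) (w : mor Z (susp X)), dist_tri u g w.
Proof.
have [W [v [w gvw]]] := tr_cone ax g.
have [X [e [e' [e'K eK]]]] := equivalence_ess_surj W equivS.
have [u Su] := equivalence_full (w \oc e) equivS.
exists X, (- u), (e' \oc v); apply/(tr_rotate ax).
rewrite fmap_opp opprK Su.
apply: (tr_iso ax (iso_id Y) (iso_id Z) (c := e') _ _ _ _ gvw).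
- by exists e.
- by rewrite comp1m compm1.
- by rewrite compm1.
by rewrite fmap1 comp1m -compmA eK compm1.
Qed.

(** * Serre duality *)

(** Hom(Sigma X, S T) is the dual of Hom(T, Sigma X), hence zero, and S T is
    isomorphic to Sigma^2 T; removing one Sigma gives Hom(X, Sigma T) = 0. *)
Lemma calabi_yau2_vanishing T X :
  calabi_yau C 2 -> hom_vanishes T (susp X) -> hom_vanishes X (susp T).
Proof.
case=> S [[_ serre] _ [eta [eta_iso _]] _] van f.
have [phi [/(_ (susp X)) [_ phi_bij] _]] := serre T.
have [e [_ etaK]] := eta_iso T.
have vanS (a b : mor (susp X) (S T)) : a = b.
  apply: (bij_inj phi_bij); apply/lfunP => g.
  by rewrite (van g) !linear0.
apply: (equivalence_faithful equivS).
have {}etaK : eta T \oc e = idm (susp (susp T)) := etaK.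
rewrite fmap0 -[fmap _ f]comp1m -etaK -compmA.
by rewrite (vanS (e \oc _) 0) compm0.
Qed.

(** * Approximations *)

(** The components of g : T^n -> X are a basis of Hom(T, X). *)
Lemma exists_approximation T X :
  exists (T0 : C) (g : mor T0 X), in_add T T0 /\
    forall t : mor T X, exists s : mor T T0, t = g \oc s.
Proof.
pose b := vbasis (fullv : {vspace mor T X}).
have [S sumS] := tr_additive ax (fun _ : 'I_(\dim {: mor T X}) => T).
have addS : in_add T S.
  apply/in_addP/(direct_sum_factors_via sumS) => i.
  exact: in_add_factors_via (in_add_self T).
case: sumS => [inj [proj [pK orth _]]].
exists S, (\sum_(i < \dim {: mor T X}) (b`_i \oc proj i)); split=> // t.
exists (\sum_(i < \dim {: mor T X}) (coord b i t *: inj i)).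
rewrite {1}(coord_vbasis (memvf t)) compm_suml; apply: eq_bigr => i _.
rewrite compm_sumr (bigD1 i) //= big1 => [|j ne_ji].
  by rewrite addr0 compmZr -compmA pK compm1.
by rewrite compmZr -compmA orth // compm0 scaler0.
Qed.

(** T1 is in add T because Hom(T, Sigma T1) = 0: a morphism T -> Sigma T1 becomes
    zero in Sigma T0, as Hom(T, Sigma T0) = 0, so it factors through h, which
    kills every T -> X. *)
Lemma cluster_tilting_resolution T X : cluster_tilting T ->
  exists (T1 T0 : C) (f : mor T1 T0) (g : mor T0 X) (h : mor X (susp T1)),
    [/\ in_add T T1, in_add T T0, dist_tri f g h
      & forall t : mor T X, h \oc t = 0].
Proof.
move=> ctT; have [T0 [g [addT0 approx]]] := exists_approximation T X.
have [T1 [f [h fgh]]] := exists_cocone g.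
have gh := (tr_rotate ax _ _ _).1 fgh.
have hf := (tr_rotate ax _ _ _).1 gh.
have ht0 (t : mor T X) : h \oc t = 0.
  by have [s ->] := approx t; rewrite compmA (dist_comp0 gh) comp0m.
exists T1, T0, f, g, h; split=> //.
apply/(ctT T1).1 => t.
have [|s ->] := dist_weak_ker (f := t) hf; last exact: ht0.
by apply: (ctT T0).1.1.
Qed.

(** * Rigidity from the three conditions *)

(** The middle hypothesis is the condition (b) at Sigma T'.  Rotating its
    triangle produces h' : T' -> T1, which is zero or right minimal because
    End(T') is local; the condition (c) excludes the former, and (a) applies to
    the latter. *)
Lemma rigid_on_local_summand T T' :
  (forall (T1 T0 : C) (f : mor T1 T0),
     in_add T T1 -> in_add T T0 -> right_minimal f ->
     forall (X : C) (g : mor T0 X) (h : mor X (susp T1)),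
       dist_tri f g h -> forall t : mor T X, h \oc t = 0) ->
  (exists (T1 T0 : C) (f : mor T1 T0) (g : mor T0 (susp T'))
          (h : mor (susp T') (susp T1)),
     [/\ in_add T T1, in_add T T0, dist_tri f g h
       & forall t : mor T (susp T'), h \oc t = 0]) ->
  local_end T' -> in_add T T' -> ~ in_add T (susp T') ->
  hom_vanishes T (susp T').
Proof.
move=> condA [T1 [T0 [f [g [h [addT1 addT0 fgh ht0]]]]]] locT' addT' naddST' t.
have [h' Sh'] := equivalence_full (- h) equivS.
have h'fg : dist_tri h' f g by apply/(tr_rotate ax); rewrite Sh' opprK.
have h'_neq0 : h' <> 0.
  move=> h'0; apply: naddST'.
  apply: (split_triangle_in_add (f := f) (g := g) addT0).
  suff <- : h = 0 by exact: fgh.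
  by apply: oppr_inj; rewrite -Sh' h'0 fmap0 oppr0.
have [|s ->] := dist_weak_ker (f := t) ((tr_rotate ax _ _ _).1 fgh).
  exact: ht0.
exact: (condA _ _ _ addT' addT1 (local_right_minimal locT' h'_neq0) _ _ _ h'fg).
Qed.

Lemma local_susp X : local_end X -> local_end (susp X).
Proof.
have iso_susp (u : mor X X) : is_iso u <-> is_iso (fmap (@susp k C) u).
  split=> [[v [vu uv]]|[v']].
    by exists (fmap susp v); rewrite -!fmapM vu uv fmap1.
  have [v <-] := equivalence_full v' equivS; rewrite -!fmapM -!fmap1.
  case=> vu uv; exists v.
  by split; apply: (equivalence_faithful equivS).
case=> id_neq0 locX; split=> [|f' g'].
  by rewrite -fmap1 -(fmap0 susp) => /(equivalence_faithful equivS).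
have [f <-] := equivalence_full f' equivS.
have [g <-] := equivalence_full g' equivS.
by rewrite -fmapD -!iso_susp; apply: locX.
Qed.

End Triangulated.

(** * The characterization of cluster-tilting objects *)

Theorem theorem25 (k : fieldType) (C : triangCat k)
    (hKS : krull_schmidt C) (hCY : calabi_yau C 2) (T : C) :
  cluster_tilting T <->
  [/\ (forall (T1 T0 : C) (f : mor T1 T0),
         in_add T T1 -> in_add T T0 -> right_minimal f ->
         forall (X : C) (g : mor T0 X) (h : mor X (susp T1)),
           dist_tri f g h -> forall t : mor T X, h \oc t = 0),
      (forall X : C, indecomposable X ->
         exists (T1 T0 : C) (f : mor T1 T0) (g : mor T0 X)
                (h : mor X (susp T1)),
           [/\ in_add T T1, in_add T T0, dist_tri f g h
             & forall t : mor T X, h \oc t = 0])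
    & (forall T' : C, indecomposable T' -> summand T' T ->
         ~ in_add T (susp T'))].
Proof.
have ax := triangCatP C; have equivS := tr_equivalence ax.
split=> [ctT|[condA condB condC]].
  split=> [T1 T0 f addT1 _ _ X g h _ t | X _
          | T' [nzT' _] [A' [inj [proj [pK _ _]]]]].
  - exact: (ctT T1).1.1.
  - exact: cluster_tilting_resolution.
  move=> /(ctT _).2 vanST'; apply: nzT'; apply/zero_objectP.
  have pi1 : proj true \oc inj true = idm T' := pK true.
  have i0 : inj true = 0 :> mor T' T.
    by apply: (equivalence_faithful equivS); rewrite fmap0; apply: vanST'.
  by rewrite -pi1 i0 compm0.
have rigid : hom_vanishes T (susp T).
  have [n [A [locA sumA]]] := hKS T.
  have vanA i : hom_vanishes T (susp (A i)).
    have sumAi : summand (A i) T.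
      by case: sumA => [inj [proj [pK _ _]]]; apply: retract_summand (pK i).
    apply: rigid_on_local_summand => //; last 1 first.
    - by apply: condC => //; apply: local_indecomposable.
    - exact/condB/local_indecomposable/local_susp.
    exact: in_add_summand.
  case: sumA => [inj [proj [_ _ tot]]] t.
  rewrite -[t]comp1m -fmap1 -tot.
  rewrite fmap_sum compm_suml big1 // => i _.
  by rewrite fmapM -compmA [_ \oc t]vanA compm0.
(* The triangle of (b) on each indecomposable summand of X splits, since its
   last morphism goes from a summand of X to Sigma of an object of add T. *)
have add_of_vanish X : hom_vanishes X (susp T) -> in_add T X.
  move=> vanX; have [n [A [locA sumA]]] := hKS X.
  apply/in_addP/(direct_sum_factors_via sumA) => i; apply/in_addP.
  have [T1 [T0 [f [g [h [addT1 addT0 fgh _]]]]]] :=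
    condB _ (local_indecomposable (locA i)).
  have vanAi : hom_vanishes (A i) (susp T).
    case: sumA => [inj [proj [pK _ _]]] t.
    by rewrite -[t]compm1 -pK compmA [t \oc _]vanX comp0m.
  apply: (split_triangle_in_add (f := f) (g := g) addT0).
  suff <- : h = 0 by exact: fgh.
  exact: factors_via_vanishr (in_add_factors_via addT1) vanAi h.
move=> X; split; split.
- move/in_add_factors_via=> viaX; exact: factors_via_vanishr viaX rigid.
- by move/(calabi_yau2_vanishing hCY); apply: add_of_vanish.
- move/in_add_factors_via=> viaX; exact: factors_via_vanishl viaX rigid.
exact: add_of_vanish.
Qed.
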